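(* Let $J:\mathbb{R}^n\to[0,\infty)$ be convex, lower semicontinuous and absolutely one-homogeneous, satisfying (PS) and (MINSUB), and let $f\in\mathbb{R}^n$. Then $$f=P_0(f)+\sum_{i}\phi_*^i,\qquad *\in\{VM,GF\},$$ is an orthogonal decomposition of the input data $f$ for the variational method as well as for the gradient flow, i.e. $$\langle\phi_*^i,\phi_*^j\rangle=0\qquad\forall\, i\ne j,\quad *\in\{VM,GF\}.$$
   Context: Absolutely one-homogeneous means $J(su)=|s|J(u)$ for all $s\in\mathbb{R}$, $u\in\mathbb{R}^n$; $\partial J$ is the convex subdifferential; $\langle\cdot,\cdot\rangle$, $\|\cdot\|$ are Euclidean; $P_0$ is the orthogonal projection onto the linear subspace $\mathcal{N}(J)=\{u:J(u)=0\}$. (PS): there exists a finite set whose convex hull equals $\partial J(0)$. (MINSUB): for all $u\in\mathbb{R}^n$, the element $\hat p=\arg\min\{\|p\|^2: p\in\partial J(u)\}$ satisfies $\langle\hat p,\hat p-q\rangle=0$ for all $q\in\partial J(u)$. Gradient flow: $\partial_tu_{GF}=-p_{GF}$, $p_{GF}(t)\in\partial J(u_{GF}(t))$ for a.e. $t>0$, $u_{GF}(0)=f$. Variational method: $u_{VM}(t)=\arg\min_u\frac12\|u-f\|^2+tJ(u)$ for $t>0$, $u_{VM}(0)=f$. Under (PS) both $u_{GF}$ and $u_{VM}$ are piecewise affine in $t$ with finitely many pieces, so for $*\in\{VM,GF\}$ the distribution $\phi_*=t\,\partial_{tt}u_*$ is a finite sum $\phi_*=\sum_i\phi_*^i\,\delta(t-t_i)$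 over the times $t_i>0$ at which the slope of $u_*$ changes, with coefficient $\phi_*^i=t_i\,(u_*'(t_i^+)-u_*'(t_i^-))$. For the gradient flow this reads $\phi_{GF}^i=t_i\,(p_{GF}(t_i)-p_{GF}(t_{i+1}))$, where $p_{GF}(t_{i+1})$ is the constant value of $p_{GF}$ on $(t_i,t_{i+1})$. *)

(* Defs.v *)
From HB Require Import structures.
From mathcomp Require Import all_boot all_order all_algebra.
From mathcomp Require Import all_classical all_reals all_analysis.
Set Implicit Arguments.
Unset Strict Implicit.
Unset Printing Implicit Defensive.
Import Order.TTheory GRing.Theory Num.Theory.
Import numFieldNormedType.Exports.
Local Open Scope classical_set_scope.
Local Open Scope ring_scope.

Section Defs.
Context {R : realType} {n : nat}.
Implicit Types (J : 'rV[R]_n -> R) (f x p : 'rV[R]_n) (A : set 'rV[R]_n).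

(* Euclidean inner product; the library norm `|x| on 'rV[R]_n is the sup norm,
   so Euclidean lengths are always written through [dot]. *)
Definition dot x p : R := \sum_(i < n) x 0 i * p 0 i.

Definition sqnorm x : R := dot x x.

Definition abs_one_homogeneous J : Prop :=
  forall (s : R) x, J (s *: x) = `|s| * J x.

Definition subdiff J x : set 'rV[R]_n :=
  [set p | forall y, J x + dot p (y - x) <= J y].

Definition is_argmin A (F : 'rV[R]_n -> R) x : Prop :=
  A x /\ forall y, A y -> F x <= F y.

Definition convex_hull A : set 'rV[R]_n :=
  smallest (@convex_set R 'rV[R]_n) A.

Definition PS J : Prop :=
  exists2 A : set 'rV[R]_n, finite_set A & convex_hull A = subdiff J 0.

Definition MINSUB J : Prop :=
  forall x p, is_argmin (subdiff J x) sqnorm p ->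
    forall q, subdiff J x q -> dot p (p - q) = 0.

Definition null_space J : set 'rV[R]_n := [set x | J x = 0].

(* The point y is unique when it exists, and exists whenever A is a linear
   subspace, so the default value 0 is never used for such A. *)
Definition orth_proj A x : 'rV[R]_n :=
  xget 0 [set y | A y /\ forall z, A z -> dot (x - y) z = 0].

(* Trajectories are functions on R of which only the restriction to [0, +oo[
   is constrained. *)
Implicit Types u : R -> 'rV[R]_n.

(* The intervals are listed from left to right and may share endpoints. Every
   norm on 'rV[R]_n gives the same notion. *)
Definition absolutely_continuous (a b : R) u : Prop :=
  forall e : R, 0 < e -> exists2 d : R, 0 < d &
    forall s : seq (R * R),
      (forall I, I \in s -> a <= I.1 /\ I.1 <= I.2 /\ I.2 <= b) ->
      pairwise (fun I K : R * R => I.2 <= K.1) s ->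
      \sum_(I <- s) (I.2 - I.1) < d ->
      \sum_(I <- s) `|u I.2 - u I.1| < e.

(* Strong solution: without local absolute continuity the almost everywhere
   inclusion would not determine u. *)
Definition gradient_flow J f u : Prop :=
  [/\ u 0 = f,
      {within [set t : R | 0 <= t], continuous u},
      (forall a b : R, 0 < a -> a <= b -> absolutely_continuous a b u) &
      exists p : R -> 'rV[R]_n,
        {ae (@lebesgue_measure R), forall t : R, 0 < t ->
           is_derive (t : R) (1 : R) u (- p t) /\ subdiff J (u t) (p t)}].

Definition variational_method J f u : Prop :=
  u 0 = f /\
  forall t : R, 0 < t ->
    is_argmin setT (fun x => 2^-1 * sqnorm (x - f) + t * J x) (u t).

(* u is affine on each compact subinterval of [0, +oo[ whose interior avoids
   the finitely many points of s; this includes the unbounded last piece and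
   forces continuity at the points of s. *)
Definition piecewise_affine u : Prop :=
  exists s : seq R, forall a b : R, 0 <= a -> a <= b ->
    (forall c, c \in s -> ~~ (a < c < b)) ->
    exists x v : 'rV[R]_n, forall t, a <= t <= b -> u t = x + t *: v.

Definition slope_right u (t : R) : 'rV[R]_n := lim (derive1 u s @[s --> t^'+]).

Definition slope_left u (t : R) : 'rV[R]_n := lim (derive1 u s @[s --> t^'-]).

Definition slope_changes u : set R :=
  [set t | 0 < t /\ slope_right u t <> slope_left u t].

(* For piecewise affine u, the coefficient at t of the distribution
   t * (d/dt)^2 u, which is a sum of Dirac masses on [slope_changes u]. *)
Definition spectral_coef u (t : R) : 'rV[R]_n :=
  t *: (slope_right u t - slope_left u t).

End Defs.

(* Main.v *)
Require Import Defs.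
From HB Require Import structures.
From mathcomp Require Import all_boot all_order all_algebra.
From mathcomp Require Import all_classical all_reals all_analysis.
From mathcomp Require Import measurable_realfun ring lra.
Import Order.TTheory GRing.Theory Num.Theory.
Import numFieldNormedType.Exports.
Local Open Scope classical_set_scope.
Local Open Scope ring_scope.
Set Implicit Arguments.
Unset Strict Implicit.
Unset Printing Implicit Defensive.

(** The subdifferential of J at x is the face of the polytope K = subdiff J 0 on
    which the functional [dot _ x] is maximal, and J is the maximum of that
    functional over K, hence over finitely many points ([sublinear_tangent],
    [PS_vertices]).  Both evolutions turn out to follow the same polygonal
    path, which starts at f and moves at each time with the velocity -p, where
    p is the element of least norm in the current subdifferential.

    MINSUB says that the whole face [subdiff J x] lies in the hyperplane
    [dot p q = sqnorm p].  Moving from x to x - r p therefore lowers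
    [dot q (x - r p)] at the same rate for all q in the face, so no subgradient
    is lost: until another vertex of K catches up, the face stays as it is, and
    at that moment it grows ([subdiff_step]).  Since there are finitely many
    vertices, the path has finitely many corners, and it stops where p = 0, that
    is in the null space of J ([critical_path_exists]).

    The faces increase along the path, so the p_i of an earlier piece is
    still a subgradient at the later nodes, and MINSUB there gives
    [dot p_j p_i = sqnorm p_j] for i <= j ([path_dot]).  Expanding
    [dot (p_i - p_(i+1)) (p_j - p_(j+1))] with this rule gives 0
    ([path_orthogonal]), and these differences are, up to the factor t_i, the
    spectral coefficients.  Their sum telescopes to f minus the end point of
    the path ([follows_sum]), which is the projection of f onto the null space
    because all the p_i are orthogonal to that space ([path_orth_proj]).

    The path is the variational trajectory because f - u(t) is the sum of the
    earlier p_i, weighted by durations of total t; all of them are subgradients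
    at u(t), so (f - u(t)) / t is one too, which is the optimality condition
    ([path_resolvent]).

    The path clearly solves the gradient flow, so what has to be shown is that
    nothing else does.  By monotonicity of the subdifferential the squared
    distance between two solutions has derivative at most 0 almost everywhere;
    absolute continuity makes it nonincreasing
    ([absolutely_continuous_nonincreasing]). *)

(** * The Euclidean inner product *)

Section InnerProduct.
Context {R : realType} {n : nat}.
Implicit Types (x y z : 'rV[R]_n) (c : R).

Lemma dotC x y : dot x y = dot y x.
Proof. by apply: eq_bigr => i _; rewrite mulrC. Qed.

Lemma dotDl x y z : dot (x + y) z = dot x z + dot y z.
Proof.
by rewrite /dot -big_split; apply: eq_bigr => i _; rewrite /= mxE mulrDl.
Qed.

Lemma dotZl c x y : dot (c *: x) y = c * dot x y.
Proof.
by rewrite /dot big_distrr; apply: eq_bigr => i _; rewrite /= mxE mulrA.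
Qed.

Lemma dotDr x y z : dot z (x + y) = dot z x + dot z y.
Proof. by rewrite dotC dotDl !(dotC z). Qed.

Lemma dotZr c x y : dot y (c *: x) = c * dot y x.
Proof. by rewrite dotC dotZl dotC. Qed.

Lemma dotNl x y : dot (- x) y = - dot x y.
Proof. by rewrite -scaleN1r dotZl mulN1r. Qed.

Lemma dotNr x y : dot y (- x) = - dot y x.
Proof. by rewrite dotC dotNl dotC. Qed.

Lemma dotBl x y z : dot (x - y) z = dot x z - dot y z.
Proof. by rewrite dotDl dotNl. Qed.

Lemma dotBr x y z : dot z (x - y) = dot z x - dot z y.
Proof. by rewrite dotDr dotNr. Qed.

Lemma dot0l y : dot 0 y = 0.
Proof. by rewrite -(scale0r 0) dotZl mul0r. Qed.

Lemma dot0r y : dot y 0 = 0.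
Proof. by rewrite dotC dot0l. Qed.

Definition dotE := (dotDl, dotDr, dotBl, dotBr, dotNl, dotNr, dotZl, dotZr).

Lemma sqnorm_ge0 x : 0 <= sqnorm x.
Proof. by apply: sumr_ge0 => i _; rewrite -expr2 sqr_ge0. Qed.

Lemma sqnorm_le0 x : sqnorm x <= 0 -> x = 0.
Proof.
move=> x_le0; have /eqP : sqnorm x = 0.
  by apply: le_anti; rewrite x_le0 sqnorm_ge0.
rewrite psumr_eq0 => [/allP x0|i _]; last by rewrite -expr2 sqr_ge0.
apply/rowP => i; rewrite mxE; apply/eqP.
by have := x0 i (mem_index_enum _); rewrite /= mulf_eq0 orbb.
Qed.

Lemma norm_entry_le x i : `|x 0 i| <= `|x|.
Proof.
rewrite [leRHS]/Num.Def.normr /= mx_normrE.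
exact: (le_bigmax _ (fun ij : 'I_1 * 'I_n => `|x ij.1 ij.2|) (0, i)).
Qed.

Lemma norm_dot_le x y : `|dot x y| <= n%:R * (`|x| * `|y|).
Proof.
apply: le_trans (ler_norm_sum _ _ _) _.
rewrite mulr_natl -[n in _ *+ n]card_ord -sumr_const; apply: ler_sum => i _.
by rewrite normrM ler_pM// norm_entry_le.
Qed.

Lemma sqnormB_le x y : `|sqnorm x - sqnorm y| <=
  n%:R * ((`|x| + `|y|) * `|x - y|).
Proof.
have -> : sqnorm x - sqnorm y = dot (x + y) (x - y).
  by rewrite /sqnorm !dotE (dotC y x); ring.
apply: le_trans (norm_dot_le _ _) _.
by rewrite ler_wpM2l// ler_wpM2r// ler_normD.
Qed.

End InnerProduct.

Lemma cvg_dot {R : realType} {n : nat} {T : Type} (F : set_system T)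
    (u v : T -> 'rV[R]_n) x y : Filter F ->
  u @ F --> x -> v @ F --> y -> dot (u t) (v t) @[t --> F] --> dot x y.
Proof.
move=> FF ux vy; apply: cvg_big => [|i _]; first exact: add_continuous.
have entry (w : T -> 'rV[R]_n) (z : 'rV[R]_n) :
    w @ F --> z -> w t 0 i @[t --> F] --> z 0 i.
  move=> wz; apply: (cvg_comp _ (fun x : 'rV[R]_n => x 0 i) wz).
  exact: coord_continuous.
exact: cvgM (entry _ _ ux) (entry _ _ vy).
Qed.

(** * Sublinear functions and their tangents *)

Section Sublinear.
Context {R : realType} {V : lmodType R}.
Implicit Types (q : V -> R) (x y v : V).

Definition sublinear q : Prop :=
  (forall x y, q (x + y) <= q x + q y) /\
  (forall c x, 0 < c -> q (c *: x) = c * q x).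

Lemma sublinear0 q : sublinear q -> q 0 = 0.
Proof. by move=> [_ qZ]; have := qZ 2 0 ltac:(lra); rewrite scaler0; lra. Qed.

Lemma sublinear_opp q x : sublinear q -> 0 <= q x + q (- x).
Proof. by move=> qP; rewrite -(sublinear0 qP) -(subrr x); apply: qP.1. Qed.

(** A sublinear q' <= q that is linear along v, with the value [q v] at v, has
    q' x = q' (x + s v) - s q v <= q (x + s v) - s q v for s >= 0; this is the
    infimum of these bounds.  For x = -v and s = 1 the bound is [- q v], so the
    infimum is itself linear along v. *)
Definition directional_inf q v x : R :=
  inf [set q (x + s *: v) - s * q v | s in [set s : R | 0 <= s]].

Lemma directional_inf_lb q v x s : sublinear q -> 0 <= s ->
  directional_inf q v x <= q (x + s *: v) - s * q v.
Proof.
move=> qP s_ge0; apply: ge_inf; last by exists s.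
exists (- q (- x)) => _ [r /= r_ge0 <-].
suff : r * q v <= q (x + r *: v) + q (- x) by lra.
rewrite (_ : r * q v = q (r *: v)); last first.
  move: r_ge0; rewrite le_eqVlt => /predU1P[<-|r_gt0].
    by rewrite mul0r scale0r sublinear0.
  by rewrite qP.2.
rewrite [in leLHS](_ : r *: v = (x + r *: v) + - x) ?qP.1//.
by rewrite addrAC subrr add0r.
Qed.

Lemma directional_inf_glb q v x m :
  (forall s, 0 <= s -> m <= q (x + s *: v) - s * q v) ->
  m <= directional_inf q v x.
Proof.
move=> m_lb; apply: lb_le_inf.
  by exists (q (x + 0 *: v) - 0 * q v), 0 => /=.
by move=> _ [s /= s_ge0 <-]; apply: m_lb.
Qed.

Lemma sublinear_directional_inf q v :
  sublinear q -> sublinear (directional_inf q v).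
Proof.
move=> qP; have lb := directional_inf_lb _ _ qP.
have le_dirZ c x : 0 < c ->
    c * directional_inf q v x <= directional_inf q v (c *: x).
  move=> c_gt0; apply: directional_inf_glb => s s_ge0.
  have sc_ge0 : 0 <= c^-1 * s by rewrite mulr_ge0// invr_ge0 ltW.
  have cN0 : c != 0 by rewrite gt_eqF.
  rewrite (_ : c *: x + s *: v = c *: (x + (c^-1 * s) *: v)); last first.
    by rewrite scalerDr scalerA mulVKf.
  rewrite qP.2// -[s in X in _ <= _ - X](mulVKf cN0) -mulrA -mulrBr.
  by rewrite ler_pM2l// lb.
split=> [x y|c x c_gt0].
  rewrite -lerBlDr; apply: directional_inf_glb => s s_ge0.
  rewrite lerBlDr -lerBlDl; apply: directional_inf_glb => r r_ge0.
  have := lb v (x + y) (s + r) (addr_ge0 s_ge0 r_ge0).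
  have := qP.1 (x + s *: v) (y + r *: v).
  rewrite [x + y + _](_ : _ = x + s *: v + (y + r *: v)); first by lra.
  by rewrite scalerDl addrACA.
apply: le_anti; rewrite le_dirZ// andbT -ler_pdivrMl//.
have := le_dirZ c^-1 (c *: x); rewrite scalerA mulVf ?gt_eqF// scale1r.
by apply; rewrite invr_gt0.
Qed.

(** The directions are treated one at a time: [directional_inf q v] is linear
    along v, and it stays so when the function decreases further, because
    [q' v + q' (- v)] can never become negative. *)
Lemma sublinear_minorant_lineal q (vs : seq V) : sublinear q ->
  exists2 q', sublinear q' & (forall x, q' x <= q x) /\
    forall v, v \in vs -> q' v + q' (- v) = 0.
Proof.
elim: vs q => [|v vs IHvs] q qP; first by exists q.
have [|q' q'P [q'_le q'0]] := IHvs (directional_inf q v).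
  exact: sublinear_directional_inf.
have lb := directional_inf_lb _ _ qP.
exists q' => //; split=> [x|w].
  apply: le_trans (q'_le x) _.
  by have := lb v x 0 (lexx _); rewrite scale0r addr0 mul0r subr0.
rewrite inE => /predU1P[->|]; last exact: q'0.
apply: le_anti; rewrite sublinear_opp// andbT.
have := lb v v 0 (lexx _); have := lb v (- v) 1 ler01.
rewrite scale1r scale0r addr0 addNr sublinear0//.
by have := q'_le v; have := q'_le (- v); lra.
Qed.

End Sublinear.

(** Hahn-Banach in finite dimension: a sublinear minorant of q that is linear
    along each vector of a basis is linear.  Starting from [directional_inf q x]
    keeps the value at x from dropping. *)
Lemma sublinear_tangent {R : realType} {n : nat} (q : 'rV[R]_n -> R) x :
  sublinear q ->
  exists2 p, forall y, dot p y <= q y & dot p x = q x.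
Proof.
move=> qP; pose e i : 'rV[R]_n := delta_mx 0 i.
have [q' q'P [q'_le lin]] :=
  sublinear_minorant_lineal [seq e i | i <- enum 'I_n]
    (sublinear_directional_inf x qP).
have {}q'_le y s : 0 <= s -> q' y <= q (y + s *: x) - s * q x.
  by move=> s_ge0; apply: le_trans (q'_le y) _; apply: directional_inf_lb.
pose p : 'rV[R]_n := \row_i q' (e i).
have q'e c i : q' (c *: e i) = c * q' (e i).
  have ei : q' (e i) + q' (- e i) = 0.
    by apply: lin; rewrite map_f// mem_enum.
  have [c_lt0|c_gt0|->] := ltgtP c 0; first 2 last.
  - by rewrite scale0r mul0r sublinear0.
  - rewrite -[in LHS](opprK c) scaleNr -scalerN q'P.2 ?oppr_gt0//.
    by move: ei => /eqP; rewrite addr_eq0 => /eqP ->; rewrite mulrN mulNr.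
  - exact: q'P.2.
have q'_le_dot y : q' y <= dot p y.
  rewrite {1}(row_sum_delta y) /dot.
  elim/big_ind2: _ => [|u a v b ua vb|i _]; first by rewrite sublinear0.
    exact: le_trans (q'P.1 _ _) (lerD ua vb).
  by rewrite q'e mulrC mxE.
have dot_le y : dot p y <= q' y.
  have := q'_le_dot (- y); have := sublinear_opp y q'P.
  by rewrite dotNr; lra.
have q'_le_q y : q' y <= q y.
  by have := q'_le y 0 (lexx _); rewrite scale0r addr0 mul0r subr0.
exists p => [y|]; first exact: le_trans (dot_le y) (q'_le_q y).
apply: le_anti; rewrite (le_trans (dot_le x) (q'_le_q x))/=.
have := q'_le (- x) 1 ler01; rewrite scale1r addNr sublinear0// mul1r.
by have := q'_le_dot x; have := sublinear_opp x q'P; lra.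
Qed.

(** * Subdifferentials of a sublinear function *)

Section Subdifferential.
Context {R : realType} {n : nat} (J : 'rV[R]_n -> R).
Implicit Types (x p q : 'rV[R]_n).

Lemma sublinear_of_convex :
  convex_function [set: 'rV[R]_n] J -> abs_one_homogeneous J -> sublinear J.
Proof.
move=> J_convex J_hom; split=> [x y|c x c_gt0]; last by rewrite J_hom gtr0_norm.
have half_ge0 : (0 : R) <= 2^-1 by lra.
have half_le1 : (2^-1 : R) <= 1 by lra.
have := J_convex (Itv01 half_ge0 half_le1) x y (in_setT _) (in_setT _).
rewrite convRE /conv/= (_ : unstable.onem 2^-1 = 2^-1); last first.
  by rewrite /unstable.onem; lra.
rewrite -scalerDr J_hom ger0_norm//; lra.
Qed.

Context (J_sublin : sublinear J).

(** The form in which subgradients are used throughout: [subdiff J x] is the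
    face of [subdiff J 0] on which [dot _ x] attains its maximum [J x]. *)
Lemma subdiffE x p :
  subdiff J x p <-> (forall y, dot p y <= J y) /\ dot p x = J x.
Proof.
split=> [pP|[p_le pE] y]; last by rewrite dotBr pE addrC subrK.
have eq_px : dot p x = J x.
  have := pP 0; have := pP (2 *: x).
  have := sublinear0 J_sublin; have := J_sublin.2 2 x ltac:(lra).
  by rewrite !dotBr dotZr dot0r; lra.
by split=> // y; have := pP y; rewrite dotBr eq_px; lra.
Qed.

Lemma subdiff0P p : subdiff J 0 p <-> forall y, dot p y <= J y.
Proof. by rewrite subdiffE dot0r sublinear0//; split=> [[]|]. Qed.

Lemma subdiff_nonempty x : exists p, subdiff J x p.
Proof.
by have [p p_le pE] := sublinear_tangent x J_sublin; exists p; apply/subdiffE.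
Qed.

(** If every a in the finite set had [dot a x < J x], then so would every point
    of the convex hull, since an open half-space is convex.  But a subgradient
    at x belongs to the hull. *)
Lemma PS_vertices : PS J -> exists2 s : seq 'rV[R]_n,
  forall a, a \in s -> subdiff J 0 a &
  forall x, exists2 a, a \in s & dot a x = J x.
Proof.
move=> [A /finite_seqP[s As] hullA]; exists s => [a a_s|x].
  by rewrite -hullA; apply: sub_gen_smallest; rewrite As.
apply: contrapT => no_vertex.
have [p] := subdiff_nonempty x; rewrite subdiffE => -[p_le pE].
have /subdiff0P := p_le; rewrite -hullA.
suff hull_lt : convex_hull A `<=` [set q | dot q x < J x].
  by move=> /hull_lt /=; rewrite pE ltxx.
apply: smallest_sub => [q r l|a aA /=].
  rewrite !inE /= => q_lt r_lt; rewrite /conv/= dotDl !dotZl /unstable.onem.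
  have l_ge0 : 0 <= l%:inum by [].
  have l_le1 : l%:inum <= 1 by [].
  move: l%:inum l_ge0 l_le1 => c c_ge0 c_le1.
  have [c_gt0|c_le0] := ltP 0 c; first by nra.
  by have -> : c = 0; lra.
rewrite lt_neqAle; apply/andP; split.
  by apply/eqP => aE; apply: no_vertex; exists a => //; move: aA; rewrite As.
have : subdiff J 0 a by rewrite -hullA; apply: sub_gen_smallest.
by move/subdiff0P; apply.
Qed.

Lemma subdiff_compact x : compact (subdiff J x).
Proof.
apply: bounded_closed_compact; last first.
  rewrite (_ : subdiff J x =
      \bigcap_(y in [set: 'rV[R]_n]) [set p | dot p (y - x) <= J y - J x]).
    apply: closed_bigI => y _.
    have /continuous_closedP dot_closed :
        continuous (fun p : 'rV[R]_n => dot p (y - x) : R).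
      move=> p; apply: (@cvg_dot _ _ _ (nbhs p) id (fun=> y - x)).
        exact: cvg_id.
      exact: cvg_cst.
    exact: dot_closed (@closed_le R (J y - J x)).
  by apply/seteqP; split=> p pP y => [_|] /=; have := pP y;
    rewrite /= -lerBrDl//; apply.
pose e i : 'rV[R]_n := delta_mx 0 i.
pose M := \sum_i (`|J (e i)| + `|J (- e i)|).
have M_ge i : `|J (e i)| + `|J (- e i)| <= M.
  by rewrite /M (bigD1 i)//= lerDl; apply: sumr_ge0 => j _; apply: addr_ge0.
exists M; split=> [|B M_lt p /subdiffE[p_le _]]; first exact: num_real.
have M_ge0 : 0 <= M by apply: sumr_ge0 => j _; apply: addr_ge0.
change (`|p| <= B); rewrite [leLHS]/Num.Def.normr /= mx_normrE.
apply: bigmax_le => [|[i0 i] _ /=].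
  exact: le_trans (ltW M_lt).
apply: le_trans (ltW M_lt); apply: le_trans (M_ge i).
have dot_e : dot p (e i) = p i0 i.
  rewrite /dot (bigD1 i)//= big1 => [|j j_i]; rewrite mxE eqxx/=.
    by rewrite eqxx mulr1 addr0 ord1.
  by rewrite (negbTE j_i) mulr0.
have := p_le (e i); have := p_le (- e i); rewrite dotNr dot_e.
have := ler_norm (J (e i)); have := ler_norm (J (- e i)).
have := normr_ge0 (J (e i)); have := normr_ge0 (J (- e i)).
by move=> *; rewrite ler_norml; apply/andP; split; lra.
Qed.

(** MINSUB in the form used below: the face [subdiff J x] lies in the hyperplane
    through its element p of least norm that is perpendicular to p. *)
Lemma min_norm_subgradient x : MINSUB J ->
  exists2 p, subdiff J x p & forall q, subdiff J x q -> dot p q = sqnorm p.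
Proof.
move=> minsub; have [|p p_sub p_min] :=
    EVT_min_rV (subdiff_nonempty x) (@subdiff_compact x) (f := sqnorm).
  apply: continuous_subspaceT => p.
  by apply: (@cvg_dot _ _ _ (nbhs p) id id); exact: cvg_id.
rewrite inE in p_sub; exists p => // q q_sub.
have := minsub x p; rewrite /is_argmin => /(_ _ q q_sub).
rewrite dotBr => /(_ _)/eqP; rewrite subr_eq0 => h.
apply/esym/eqP; apply: h; split=> // r r_sub.
by apply: p_min; rewrite inE.
Qed.

(** All the elements q of the face at x have the same product with p, so
    [dot q (x - r *: p)] decreases from [J x] at the common rate [sqnorm p].
    They remain maximal as long as no vertex with a smaller rate overtakes
    them.  One must do so at some time T, as otherwise J would become negative,
    and it is then active at time T without having been active at x. *)
Lemma subdiff_step x p (s : seq 'rV[R]_n) :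
  (forall y, 0 <= J y) ->
  (forall a, a \in s -> subdiff J 0 a) ->
  (forall y, exists2 a, a \in s & dot a y = J y) ->
  (forall q, subdiff J x q -> dot p q = sqnorm p) ->
  p != 0 ->
  exists2 T, 0 < T &
    (forall r, 0 <= r <= T -> subdiff J x `<=` subdiff J (x - r *: p)) /\
    (exists2 a, a \in s & subdiff J (x - T *: p) a /\ dot a p < sqnorm p).
Proof.
move=> J_ge0 s_sub s_max p_eq p_neq0.
have p_gt0 : 0 < sqnorm p.
  rewrite lt_neqAle sqnorm_ge0 andbT eq_sym; apply: contra p_neq0 => /eqP p0.
  by apply/eqP/sqnorm_le0; rewrite p0.
have [q q_sub] := subdiff_nonempty x; have /subdiffE[q_le qx] := q_sub.
(* The time at which a vertex a with dot a p < sqnorm p overtakes the face. *)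
pose hit a := (J x - dot a x) / (sqnorm p - dot a p).
pose B := [seq a <- s | dot a p < sqnorm p].
have B_neq0 : B != [::].
  (* At this time J would have decreased to -1 or less. *)
  apply/eqP => B0; pose r := (J x + 1) / sqnorm p.
  have r_gt0 : 0 < r by rewrite divr_gt0// ltr_wpDl.
  have [a a_s aE] := s_max (x - r *: p).
  have ap : sqnorm p <= dot a p.
    have : a \notin B by rewrite B0.
    by rewrite mem_filter a_s andbT leNgt.
  have ax : dot a x <= J x by have /subdiff0P := s_sub a a_s; apply.
  have rE : r * sqnorm p = J x + 1 by rewrite /r divfK ?gt_eqF.
  have := J_ge0 (x - r *: p); rewrite -aE dotBr dotZr.
  have : r * sqnorm p <= r * dot a p by rewrite ler_pM2l.
  by lra.
have [a aB a_min] : exists2 a, a \in B & forall b, b \in B -> hit a <= hit b.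
  elim: {q q_sub q_le qx} B B_neq0 => // b [_ _|c B IHB _].
    by exists b; rewrite ?mem_head// => c; rewrite inE => /eqP ->.
  have [a aB a_min] := IHB isT.
  have [le_ab|/ltW le_ba] := leP (hit a) (hit b).
    exists a => [|d]; first by rewrite in_cons aB orbT.
    by rewrite in_cons => /predU1P[->//|]; apply: a_min.
  exists b => [|d]; first exact: mem_head.
  by rewrite in_cons => /predU1P[->//|/a_min]; apply: le_trans.
have /[!mem_filter]/andP[ap_lt a_s] := aB.
have a_le : forall y, dot a y <= J y by apply/subdiff0P/s_sub.
have ax_lt : dot a x < J x.
  rewrite lt_neqAle a_le andbT; apply/eqP => ax.
  have /p_eq : subdiff J x a by apply/subdiffE.
  by rewrite dotC => apE; rewrite apE ltxx in ap_lt.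
have J_le r : 0 <= r <= hit a -> J (x - r *: p) <= J x - r * sqnorm p.
  move=> /andP[r_ge0 r_le].
  have [b b_s <-] := s_max (x - r *: p).
  have bx : dot b x <= J x by have /subdiff0P := s_sub b b_s; apply.
  rewrite dotBr dotZr; have [b_B|] := boolP (b \in B).
    have /[!mem_filter]/andP[bp_lt _] := b_B.
    have := le_trans r_le (a_min b b_B).
    rewrite /hit ler_pdivlMr ?subr_gt0// => h; lra.
  rewrite mem_filter b_s andbT -leNgt => bp.
  have : r * sqnorm p <= r * dot b p by rewrite ler_wpM2l.
  by lra.
have hit_gt0 : 0 < hit a by rewrite divr_gt0// subr_gt0.
have decr r : 0 <= r <= hit a ->
    J (x - r *: p) = J x - r * sqnorm p.
  move=> r_in; apply: le_anti; rewrite J_le//=.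
  by have := q_le (x - r *: p); rewrite dotBr dotZr qx (dotC q) p_eq.
exists (hit a) => //; split=> [r r_in c c_sub|].
  have /subdiffE[c_le cx] := c_sub; apply/subdiffE; split=> //.
  by rewrite decr// dotBr dotZr cx (dotC c) p_eq.
exists a => //; split=> //; apply/subdiffE; split=> //.
rewrite decr ?lexx ?ltW// dotBr dotZr.
have : hit a * (sqnorm p - dot a p) = J x - dot a x.
  by rewrite /hit divfK// gt_eqF// subr_gt0.
by rewrite mulrBr; lra.
Qed.

End Subdifferential.

(** * The critical path *)

(** The polygonal path of steepest descent from f: at the node [xx k], reached
    at time [tau k], it turns into the direction [- pp k].  By [path_subdiff]
    and [path_min], [pp k] is the element of least norm of the subdifferential
    at that node.  The path stops for ever at the node N. *)
Record critical_path {R : realType} {n : nat} (J : 'rV[R]_n -> R) f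
    (N : nat) (tau : nat -> R) (xx pp : nat -> 'rV[R]_n) : Prop :=
  CriticalPath {
  path_time0 : tau 0 = 0;
  path_start : xx 0 = f;
  path_lt : forall k, (k < N)%N -> tau k < tau k.+1;
  path_next : forall k, xx k.+1 = xx k - (tau k.+1 - tau k) *: pp k;
  path_subdiff : forall k, subdiff J (xx k) (pp k);
  path_min : forall k q, subdiff J (xx k) q -> dot (pp k) q = sqnorm (pp k);
  path_persist : forall k r, (k < N)%N -> 0 <= r <= tau k.+1 - tau k ->
    subdiff J (xx k) `<=` subdiff J (xx k - r *: pp k);
  path_stop : pp N = 0;
  path_turn : forall k, (k < N)%N -> pp k.+1 <> pp k }.

Section CriticalPath.
Context {R : realType} {n : nat} (J : 'rV[R]_n -> R) (f : 'rV[R]_n).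

(** Iterating [subdiff_step] ends because each step with a nonzero velocity adds
    an active vertex to those that were active before.  The new vertex also
    shows that [pp k] does not have the least norm at the next node, so the path
    really turns there. *)
Lemma critical_path_exists :
  sublinear J -> (forall x, 0 <= J x) -> PS J -> MINSUB J ->
  exists N tau xx pp, critical_path J f N tau xx pp.
Proof.
move=> J_sublin J_ge0 /(PS_vertices J_sublin)[s s_sub s_max] minsub.
pose good x (y : 'rV[R]_n * R) := [/\ subdiff J x y.1,
  forall q, subdiff J x q -> dot y.1 q = sqnorm y.1,
  0 < y.2,
  forall r, 0 <= r <= y.2 -> subdiff J x `<=` subdiff J (x - r *: y.1) &
  y.1 != 0 -> exists2 a, a \in s &
    subdiff J (x - y.2 *: y.1) a /\ dot a y.1 < sqnorm y.1].
have /choice[pT pTP] : forall x, exists y, good x y.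
  move=> x.
  have [p p_sub p_min] := min_norm_subgradient J_sublin x minsub.
  (* A path that has stopped is continued by steps of length 1. *)
  have [p0|p_neq0] := eqVneq p 0.
    by exists (p, 1); split=> //= [r _|]; rewrite p0 ?scaler0 ?subr0// eqxx.
  have [T T_gt0 [persist new]] :=
    subdiff_step J_sublin J_ge0 s_sub s_max p_min p_neq0.
  by exists (p, T).
pose st k := iter k (fun y : R * 'rV[R]_n =>
  (y.1 + (pT y.2).2, y.2 - (pT y.2).2 *: (pT y.2).1)) (0, f).
pose pp k := (pT (st k).2).1.
have st2S k : (st k.+1).2 = (st k).2 - (pT (st k).2).2 *: pp k by [].
pose active x := count (fun a => `[< subdiff J x a >]) s.
have active_lt k : pp k != 0 -> (active (st k).2 < active (st k.+1).2)%N.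
  have [_ p_min T_gt0 persist new] := pTP (st k).2.
  move=> /new[a a_s [a_sub a_lt]].
  have sub_next : subdiff J (st k).2 `<=` subdiff J (st k.+1).2.
    by rewrite st2S; apply: persist; rewrite lexx ltW.
  have a_old : ~ subdiff J (st k).2 a.
    by move=> a_sub0; rewrite dotC (p_min a a_sub0) ltxx in a_lt.
  rewrite -st2S in a_sub; rewrite /active.
  move: (st k.+1).2 sub_next a_sub => x sub_next a_sub.
  rewrite !(permP (perm_to_rem a_s))/= asboolF// asboolT//.
  rewrite add0n add1n ltnS; apply: sub_count => b /asboolP b_sub.
  exact/asboolP/sub_next.
have stops : exists k, pp k == 0.
  apply: contrapT => never.
  have active_ge k : (k <= active (st k).2)%N.
    elim: k => // k IHk; apply: leq_ltn_trans IHk (active_lt k _).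
    by apply/negP => pk0; apply: never; exists k.
  have := active_ge (size s).+1; rewrite leqNgt.
  by rewrite ltnS count_size.
have [N /eqP pN0 N_min] := ex_minnP stops.
exists N, (fun k => (st k).1), (fun k => (st k).2), pp.
have step k : (st k.+1).1 - (st k).1 = (pT (st k).2).2.
  by rewrite /= addrC addKr.
split=> // [k _|k|k|k|k r _|k kN].
- by rewrite -subr_gt0 step; have [] := pTP (st k).2.
- by rewrite step.
- by have [] := pTP (st k).2.
- by have [] := pTP (st k).2.
- by rewrite step; have [_ _ _ + _] := pTP (st k).2; apply.
have pk_neq0 : pp k != 0.
  by apply: contraTneq kN => pk0; rewrite -leqNgt N_min ?pk0.
have [_ _ _ _ /(_ pk_neq0)[a _ [a_sub a_lt]]] := pTP (st k).2.
move=> pE; have [_ /(_ a a_sub) aE _ _ _] := pTP (st k.+1).2.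
by move: a_lt; rewrite -/(pp k) -pE dotC /pp aE ltxx.
Qed.

Context {N : nat} {tau : nat -> R} {xx pp : nat -> 'rV[R]_n}.
Context (path : critical_path J f N tau xx pp).

Lemma path_subdiff_le i j : (i <= j <= N)%N ->
  subdiff J (xx i) `<=` subdiff J (xx j).
Proof.
move=> /andP[]; elim: j => [|j IHj]; first by rewrite leqn0 => /eqP-> _.
rewrite leq_eqVlt => /predU1P[-> _ //|i_le_j j_lt_N].
apply: subset_trans (IHj _ (ltnW j_lt_N)) _ => //.
rewrite (path_next path); apply: (path_persist path) => //.
by rewrite lexx subr_ge0 ltW// (path_lt path).
Qed.

(** [pp i] is still a subgradient at the later node j, so it lies in the
    hyperplane perpendicular to [pp j]. *)
Lemma path_dot i j : (i <= j <= N)%N -> dot (pp j) (pp i) = sqnorm (pp j).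
Proof.
move=> ij; apply: (path_min path).
exact: path_subdiff_le ij _ (path_subdiff path i).
Qed.

Lemma path_orthogonal i j : (i < j < N)%N ->
  dot (pp i.+1 - pp i) (pp j.+1 - pp j) = 0.
Proof.
move=> /andP[ij jN]; rewrite dotC !dotBl !dotBr.
rewrite !path_dot ?ij ?jN ?(ltnW jN) ?(leqW ij) ?(ltnW ij) ?andbT//.
  by ring.
by rewrite (leqW (ltnW ij)).
Qed.

End CriticalPath.

(** * The spectral decomposition of a trajectory along the path *)

Section Slopes.
Context {R : realType} {n : nat}.
Implicit Types (u : R -> 'rV[R]_n) (x v : 'rV[R]_n).

Lemma derive1_affine u a b x v s :
  (forall r, a < r < b -> u r = x + r *: v) -> a < s < b -> derive1 u s = v.
Proof.
move=> uE asb; have /andP[a_s s_b] := asb; apply: cvg_lim => //.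
apply: cvg_near_cst; near=> h.
have h_neq0 : h != 0 by near: h; apply: nbhs_dnbhs_neq.
have /andP[h_gt h_lt] : a - s < h < b - s.
  near: h; apply: nbhs_dnbhs; apply: (near_in_itvoo (a := a - s) (b := b - s)).
  by rewrite in_itv/= subr_lt0 a_s subr_gt0.
rewrite !uE//; last by apply/andP; split; lra.
rewrite opprD addrACA subrr add0r -scalerBl addrK scalerA mulVf ?scale1r//.
Unshelve. all: by end_near. Qed.

Lemma slope_right_affine u t b x v : t < b ->
  (forall s, t < s < b -> u s = x + s *: v) -> slope_right u t = v.
Proof.
move=> tb uE; apply: cvg_lim => //; apply: cvg_near_cst; near=> s.
apply: (derive1_affine uE); apply/andP; split.
- by near: s; apply: nbhs_right_gt.
- by near: s; apply: nbhs_right_lt.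
Unshelve. all: by end_near. Qed.

Lemma slope_left_affine u t a x v : a < t ->
  (forall s, a < s < t -> u s = x + s *: v) -> slope_left u t = v.
Proof.
move=> a_t uE; apply: cvg_lim => //; apply: cvg_near_cst; near=> s.
apply: (derive1_affine uE); apply/andP; split.
- by near: s; apply: nbhs_left_gt.
- by near: s; apply: nbhs_left_lt.
Unshelve. all: by end_near. Qed.

End Slopes.

Section Decomposition.
Context {R : realType} {n : nat} (J : 'rV[R]_n -> R) (f : 'rV[R]_n).
Context {N : nat} {tau : nat -> R} {xx pp : nat -> 'rV[R]_n}.
Context (path : critical_path J f N tau xx pp).

Lemma path_time_lt i j : (i < j <= N)%N -> tau i < tau j.
Proof.
move=> /andP[]; elim: j => // j IHj.
rewrite ltnS leq_eqVlt => /predU1P[->|ij] jN.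
  exact: (path_lt path).
by apply: lt_trans (IHj ij (ltnW jN)) (path_lt path jN).
Qed.

Lemma path_locate t : 0 <= t -> exists k, [/\ (k <= N)%N, tau k <= t &
  (k < N)%N -> t < tau k.+1].
Proof.
move=> t_ge0.
have upto m : (m <= N)%N -> tau m <= t \/
    exists k, [/\ (k < m)%N, tau k <= t & t < tau k.+1].
  elim: m => [_|m IHm mN]; first by left; rewrite (path_time0 path).
  have [tm|t_lt] := leP (tau m.+1) t; first by left.
  right; have [tm|[k [km tk t_k]]] := IHm (ltnW mN); first by exists m.
  by exists k; split=> //; apply: ltnW.
have [tN|[k [kN tk t_k]]] := upto N (leqnn _).
  by exists N; split=> //; rewrite ltnn.
by exists k; split=> //; apply: ltnW.
Qed.

Definition follows (u : R -> 'rV[R]_n) : Prop :=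
  forall k t, (k <= N)%N -> tau k <= t -> ((k < N)%N -> t <= tau k.+1) ->
    u t = xx k - (t - tau k) *: pp k.

Context (u : R -> 'rV[R]_n) (u_path : follows u).

Lemma path_affine k t : (k <= N)%N -> tau k <= t ->
  ((k < N)%N -> t <= tau k.+1) -> u t = (xx k + tau k *: pp k) + t *: - pp k.
Proof.
move=> kN tk t_k; rewrite (u_path kN)// scalerBl opprB scalerN.
by rewrite -addrA.
Qed.

Lemma follows_piecewise_affine : piecewise_affine u.
Proof.
exists [seq tau k | k <- iota 0 N.+1] => a b a_ge0 ab breaks.
have [k [kN tk a_k]] := path_locate a_ge0.
exists (xx k + tau k *: pp k), (- pp k) => t /andP[a_t t_b].
apply: path_affine => //; first exact: le_trans tk a_t.
move=> k_lt; apply: le_trans t_b _; rewrite leNgt; apply/negP => b_gt.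
have /negP := breaks (tau k.+1) ltac:(by rewrite map_f// mem_iota ltnS).
by apply; rewrite a_k.
Qed.

Lemma follows_slope_right k t : (k <= N)%N -> tau k <= t ->
  ((k < N)%N -> t < tau k.+1) -> slope_right u t = - pp k.
Proof.
move=> kN tk t_k; pose b := if (k < N)%N then tau k.+1 else t + 1.
apply: (@slope_right_affine _ _ _ _ b (xx k + tau k *: pp k)).
  by rewrite /b; case: ifP => [/t_k//|_]; rewrite ltrDl.
move=> s /andP[t_s s_b]; apply: path_affine => //.
  exact: le_trans tk (ltW t_s).
by move=> k_lt; move: s_b; rewrite /b k_lt => /ltW.
Qed.

Lemma follows_slope_left k t : (k <= N)%N -> tau k < t ->
  ((k < N)%N -> t <= tau k.+1) -> slope_left u t = - pp k.
Proof.
move=> kN tk t_k.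
apply: (@slope_left_affine _ _ _ _ (tau k) (xx k + tau k *: pp k)) => //.
move=> s /andP[t_s s_b]; apply: path_affine (ltW t_s) _ => //.
by move=> /t_k; apply: le_trans (ltW s_b).
Qed.

Lemma path_time_gt0 k : (k < N)%N -> 0 < tau k.+1.
Proof. by move=> kN; rewrite -(path_time0 path) path_time_lt. Qed.

Lemma follows_slope_changes : slope_changes u = [set tau k.+1 | k in `I_N].
Proof.
have right_at k : (k < N)%N -> slope_right u (tau k.+1) = - pp k.+1.
  by move=> kN; apply: follows_slope_right => // /(path_lt path).
have left_at k : (k < N)%N -> slope_left u (tau k.+1) = - pp k.
  move=> kN; apply: follows_slope_left (path_lt path kN) _ => //.
  exact: ltnW.
apply/seteqP; split=> [t [t_gt0 turn]|_ [k /= kN <-]]; last first.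
  split; first exact: path_time_gt0.
  by rewrite right_at// left_at// => /oppr_inj; apply: (path_turn path).
have [k [kN tk t_k]] := path_locate (ltW t_gt0).
move: (tk); rewrite le_eqVlt => /predU1P[tE|tk_lt]; last first.
  case: turn; rewrite (follows_slope_right kN tk t_k).
  by rewrite (follows_slope_left kN tk_lt)// => /t_k/ltW.
case: k kN tk t_k tE => [|k] kN _ _ tE; last by exists k.
by move: t_gt0; rewrite -tE (path_time0 path) ltxx.
Qed.

Lemma follows_coef k : (k < N)%N ->
  spectral_coef u (tau k.+1) = tau k.+1 *: (pp k - pp k.+1).
Proof.
move=> kN; rewrite /spectral_coef.
rewrite (@follows_slope_right k.+1)//; last by move/(path_lt path).
rewrite (@follows_slope_left k)//; [|exact: ltnW|exact: (path_lt path)].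
by rewrite opprK addrC.
Qed.

(** Summation by parts: t_(k+1) is the total duration of the pieces up to k, so
    the weighted jumps of the velocity add up to the displacement. *)
Lemma follows_sum :
  \sum_(t \in slope_changes u) spectral_coef u t = f - xx N.
Proof.
rewrite follows_slope_changes fsbig_image; last first.
  move=> i j; rewrite !inE/= => iN jN /eqP; have [ij|ij|//] := ltngtP i j.
    by rewrite lt_eqF// path_time_lt// ltnS ij.
  by rewrite gt_eqF// path_time_lt// ltnS ij.
rewrite -fsbig_ord; under eq_bigr => k _ do rewrite follows_coef//.
suff abel m :
    \sum_(k < m) tau k.+1 *: (pp k - pp k.+1) + tau m *: pp m = f - xx m.
  by rewrite -abel (path_stop path) scaler0 addr0.
elim: m => [|m IHm].
  by rewrite big_ord0 (path_time0 path) scale0r (path_start path) subrr addr0.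
rewrite big_ord_recr/= (path_next path) scalerBr -addrA subrK.
rewrite opprB addrCA -IHm scalerBl [in RHS](addrC _ (tau m *: pp m)).
by rewrite addrA subrK addrC.
Qed.

Lemma follows_orthogonal s t :
  slope_changes u s -> slope_changes u t -> s <> t ->
  dot (spectral_coef u s) (spectral_coef u t) = 0.
Proof.
rewrite follows_slope_changes => -[i /= iN <-] [j /= jN <-] ij.
rewrite !follows_coef// dotZl dotZr -(opprB (pp i.+1)) -(opprB (pp j.+1)).
rewrite dotNl dotNr opprK; have [ij_lt|ij_gt|ijE] := ltngtP i j.
- by rewrite (path_orthogonal path) ?ij_lt ?mulr0.
- by rewrite dotC (path_orthogonal path) ?ij_gt ?mulr0.
- by case: ij; rewrite ijE.
Qed.

(** A subgradient p satisfies [dot p z <= J z] and [dot p (- z) <= J z], so p is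
    orthogonal to z when [J z = 0], and so is f minus the end of the path.
    At the end 0 is a subgradient, that is, J vanishes there. *)
Lemma path_orth_proj : sublinear J -> (forall x, 0 <= J x) ->
  abs_one_homogeneous J -> orth_proj (null_space J) f = xx N.
Proof.
move=> J_sublin J_ge0 J_hom.
have orth k z : J z = 0 -> dot (f - xx k) z = 0.
  move=> Jz; elim: k => [|k IHk].
    by rewrite (path_start path) subrr dot0l.
  have [p_le _] := (subdiffE J_sublin (xx k) (pp k)).1 (path_subdiff path k).
  have pz : dot (pp k) z = 0.
    have := p_le z; have := p_le (- z).
    by rewrite -scaleN1r J_hom Jz mulr0 dotZr; lra.
  by rewrite (path_next path) opprB addrCA dotDl IHk dotZl pz mulr0 addr0.
have JxN : null_space J (xx N).
  have [_ xN] := (subdiffE J_sublin (xx N) (pp N)).1 (path_subdiff path N).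
  by rewrite /null_space /= -xN (path_stop path) dot0l.
have : [set y | null_space J y /\
    forall z, null_space J z -> dot (f - y) z = 0] (xx N).
  by split=> // z; apply: orth.
rewrite /orth_proj; case: xgetP => [y _ [Jy y_orth] _|/(_ (xx N))//].
have Jd : J (y - xx N) = 0.
  apply: le_anti; rewrite J_ge0 andbT; apply: le_trans (J_sublin.1 _ _) _.
  by rewrite Jy -scaleN1r J_hom [J (xx N)]JxN mulr0 addr0.
apply/eqP; rewrite -subr_eq0; apply/eqP/sqnorm_le0.
have := orth N _ Jd; have := y_orth _ Jd; rewrite /sqnorm !dotBl => hy hN.
lra.
Qed.

Lemma follows_decomposition : sublinear J -> (forall x, 0 <= J x) ->
  abs_one_homogeneous J ->
  [/\ piecewise_affine u,
      finite_set (slope_changes u),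
      f = orth_proj (null_space J) f
          + \sum_(t \in slope_changes u) spectral_coef u t &
      forall s t, slope_changes u s -> slope_changes u t -> s <> t ->
        dot (spectral_coef u s) (spectral_coef u t) = 0].
Proof.
move=> J_sublin J_ge0 J_hom; split.
- exact: follows_piecewise_affine.
- by rewrite follows_slope_changes; apply: finite_image; apply: finite_II.
- by rewrite path_orth_proj// follows_sum addrC subrK.
- exact: follows_orthogonal.
Qed.

End Decomposition.

(** * The variational method follows the path *)

Section VariationalMethod.
Context {R : realType} {n : nat} (J : 'rV[R]_n -> R) (f : 'rV[R]_n).
Context {N : nat} {tau : nat -> R} {xx pp : nat -> 'rV[R]_n}.
Context (path : critical_path J f N tau xx pp).

Lemma path_time_ge0 k : (k <= N)%N -> 0 <= tau k.
Proof.
case: k => [_|k kN]; first by rewrite (path_time0 path).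
by rewrite ltW// (path_time_gt0 path).
Qed.

Lemma path_segment_subdiff k t : (k <= N)%N -> tau k <= t ->
  ((k < N)%N -> t <= tau k.+1) ->
  subdiff J (xx k) `<=` subdiff J (xx k - (t - tau k) *: pp k).
Proof.
move=> kN tk t_k; move: (kN); rewrite leq_eqVlt => /predU1P[->|k_lt].
  by rewrite (path_stop path) scaler0 subr0.
by apply: (path_persist path k_lt); rewrite subr_ge0 tk lerD2r t_k.
Qed.

(** f - xx k is the sum of the subgradients [pp i], i < k, weighted by the
    durations of their pieces.  If the face at [xx k] is contained in the one at
    z, they are all subgradients at z, and so is their average over the time
    [tau k].  Multiplying by this time includes the case [tau k = 0]. *)
Lemma path_mean_subgradient k z y : (k <= N)%N ->
  subdiff J (xx k) `<=` subdiff J z ->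
  tau k * J z + dot (f - xx k) (y - z) <= tau k * J y.
Proof.
elim: k z => [|k IHk] z kN sub_z.
  by rewrite (path_time0 path) (path_start path) subrr dot0l !mul0r addr0.
have sub_k : subdiff J (xx k) `<=` subdiff J z.
  by apply: subset_trans sub_z; apply: (path_subdiff_le path); rewrite leqnSn.
have := IHk z (ltnW kN) sub_k; have := sub_k _ (path_subdiff path k) y.
have dt_ge0 : 0 <= tau k.+1 - tau k by rewrite subr_ge0 ltW// (path_lt path).
have -> : f - xx k.+1 = f - xx k + (tau k.+1 - tau k) *: pp k.
  by rewrite (path_next path) opprB addrCA addrC.
move=> /(ler_wpM2l dt_ge0); rewrite (dotDl (f - xx k)) dotZl; lra.
Qed.

Lemma path_resolvent k t y (z := xx k - (t - tau k) *: pp k) :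
  (k <= N)%N -> tau k <= t -> ((k < N)%N -> t <= tau k.+1) ->
  t * J z + dot (f - z) (y - z) <= t * J y.
Proof.
move=> kN tk t_k; have sub_z := path_segment_subdiff kN tk t_k.
have := path_mean_subgradient y kN sub_z; rewrite -/z.
have := sub_z _ (path_subdiff path k) y; rewrite -/z.
have dt_ge0 : 0 <= t - tau k by rewrite subr_ge0.
have -> : f - z = f - xx k + (t - tau k) *: pp k.
  by rewrite /z opprB addrCA addrC.
by move=> /(ler_wpM2l dt_ge0); rewrite (dotDl (f - xx k)) dotZl; lra.
Qed.

(** Adding the optimality condition at the point z of the path to the minimality
    of [u t] leaves [sqnorm (u t - z) <= 0]. *)
Lemma variational_method_follows u : variational_method J f u ->
  @follows R n N tau xx pp u.
Proof.
move=> [u0 u_min] k t kN tk t_k.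
have : 0 <= t := le_trans (path_time_ge0 kN) tk.
rewrite le_eqVlt => /predU1P[t0|t_gt0].
  case: k kN tk t_k => [|k] kN tk t_k; last first.
    by have := path_time_gt0 path kN; rewrite t0 ltNge tk.
  by rewrite -t0 u0 (path_time0 path) (path_start path) subrr scale0r subr0.
have := path_resolvent (u t) kN tk t_k.
set z := xx k - _ => z_opt.
have [_ /(_ z I) u_le] := u_min t t_gt0.
apply/eqP; rewrite -subr_eq0; apply/eqP/sqnorm_le0.
move: z z_opt u_le => z.
rewrite /sqnorm !dotE (dotC f z) (dotC f (u t)) (dotC z (u t)).
lra.
Qed.

End VariationalMethod.

(** * Absolutely continuous functions with nonpositive derivative *)

Section Monotonicity.
Context {R : realType}.
Local Notation mu := (@lebesgue_measure R).

(** Q propagates from a to b if each point c has a neighbourhood in which Q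
    passes from any x on the left of c to any y on the right: apply this to the
    supremum c of the points reached so far. *)
Lemma interval_induction (Q : R -> Prop) (a b : R) : a <= b -> Q a ->
  (forall c, a <= c <= b -> exists2 d, 0 < d & forall x y,
    a <= x <= c -> c <= y <= b -> y - x < d -> Q x -> Q y) -> Q b.
Proof.
move=> ab Qa step; pose S := [set x | a <= x <= b /\ Q x].
have S_a : S a by rewrite /S /= lexx ab.
have S_ub : has_ubound S by exists b => x [/andP[]].
have S_sup : has_sup S by split; first by exists a.
set c := sup S.
have ac : a <= c by apply: ub_le_sup.
have cb : c <= b by apply: ge_sup => [|x [/andP[]]//]; exists a.
have [|d d_gt0 stepc] := step c; first by rewrite ac.
have d2_gt0 : 0 < d / 2 by lra.
have [x xS cx] := sup_adherent d2_gt0 S_sup; have [/andP[ax xb] Qx] := xS.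
have xc : x <= c by apply: ub_le_sup.
have [cb_lt|b_le] := ltP (c + d / 3) b; last first.
  by apply: stepc Qx; rewrite ?ax ?xc ?cb ?lexx//; rewrite -/c in cx; lra.
have Qy : Q (c + d / 3).
  apply: stepc Qx; rewrite ?ax ?xc ?cb ?lexx//.
    by apply/andP; split; lra.
  by rewrite -/c in cx; lra.
have : c + d / 3 <= c.
  by apply: ub_le_sup => //; split=> //; apply/andP; split; lra.
by move=> ?; exfalso; lra.
Qed.

Lemma derive_le0_local (g : R -> R) (t d e : R) :
  is_derive t 1 g d -> d <= 0 -> 0 < e ->
  exists2 r, 0 < r & forall x y, x <= t <= y -> y - x < r ->
    g y - g x <= e * (y - x).
Proof.
move=> [g_dv g_v] d_le0 e_gt0.
have quot : h^-1 *: (g (h *: 1 + t) - g t) @[h --> 0^'] --> d.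
  by rewrite -g_v; exact: g_dv.
have [r /= r_gt0 r_quot] := cvgr_lt _ quot e (le_lt_trans d_le0 e_gt0).
have {}r_quot h : `|h| < r -> h != 0 -> h^-1 * (g (h + t) - g t) < e.
  move=> h_lt h_neq0; have := r_quot h; rewrite /ball_ /= sub0r normrN.
  by rewrite [_ *: 1]mulr1; apply.
exists r => // x y /andP[xt ty] yx.
have right : g y - g t <= e * (y - t).
  move: ty; rewrite le_eqVlt => /predU1P[->|ty]; first by rewrite !subrr mulr0.
  have := r_quot (y - t).
  rewrite subrK gt_eqF ?subr_gt0// gtr0_norm ?subr_gt0//.
  have -> : y - t < r by lra.
  by rewrite ltr_pdivrMl ?subr_gt0// => /(_ isT isT)/ltW; rewrite mulrC.
have left : g t - g x <= e * (t - x).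
  move: xt; rewrite le_eqVlt => /predU1P[->|xt]; first by rewrite !subrr mulr0.
  have := r_quot (x - t).
  rewrite subrK lt_eqF ?subr_lt0// ltr0_norm ?subr_lt0//.
  have -> : - (x - t) < r by lra.
  by rewrite ltr_ndivrMl ?subr_lt0// => /(_ isT isT)/ltW; lra.
by lra.
Qed.

Lemma measure_extend (U : set R) (x y : R) : measurable U -> x <= y ->
  `[x, y] `<=` U ->
  (mu (U `&` `]-oo, x[) + (y - x)%:E <= mu (U `&` `]-oo, y[))%E.
Proof.
move=> mU xy xyU.
have len : mu `[x, y[ = (y - x)%:E.
  rewrite lebesgue_measure_itv/= lte_fin.
  by move: xy; rewrite le_eqVlt => /predU1P[->|->//]; rewrite ltxx subrr.
rewrite -len -measureU//=; last 2 first.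
- exact: measurableI.
- rewrite -subset0 => r [[_ /=]]; rewrite !in_itv/= => rx /andP[xr _].
  by move: xr; rewrite leNgt rx.
apply: le_measure; rewrite ?inE.
- by apply: measurableU => //; apply: measurableI.
- exact: measurableI.
move=> r [[Ur /=]|/=]; rewrite !in_itv/=.
  by move=> rx; split=> //; apply: lt_le_trans rx xy.
move=> /andP[xr ry]; split=> //.
by apply: xyU; rewrite /= in_itv/= xr ltW.
Qed.

(** Enclose the exceptional null set in an open set U of small measure and walk
    from a to b in small steps.  Near a point that is not exceptional
    the increase of g is controlled by the derivative, with an arbitrarily small
    slope e.  Near an exceptional point the step lies inside U; such steps have
    a total length at most the measure of U, so absolute continuity bounds the
    total increase of g over them.  Absolute continuity is required of u only,
    in terms of which the increments of g are estimated: g will be a squared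
    distance to u. *)
Lemma absolutely_continuous_nonincreasing {n : nat}
    (u : R -> 'rV[R]_n) (g : R -> R) (a b C : R) :
  a <= b -> 0 <= C -> absolutely_continuous a b u ->
  (forall s t, a <= s -> s <= t -> t <= b ->
    `|g t - g s| <= C * (`|u t - u s| + (t - s))) ->
  {ae mu, forall t : R, a <= t <= b ->
    exists2 d, is_derive (t : R) (1 : R) g d & d <= 0} ->
  g b <= g a.
Proof.
move=> ab C_ge0 u_ac g_le [A [mA A0 subA]].
apply/ler_addgt0Pr => e' e'_gt0.
pose K := (b - a) + 2 * C + 1.
have K_gt0 : 0 < K by rewrite /K; lra.
pose e := e' / K; have e_gt0 : 0 < e by rewrite divr_gt0.
have [d d_gt0 small] := u_ac e e_gt0.
have m_gt0 : 0 < Num.min d e by rewrite lt_min d_gt0.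
have [|U [oU AU UA_lt]] := lebesgue_regularity_outer mA _ m_gt0.
  by rewrite [X in (X < _)%E]A0 ltry.
have mU : measurable U by exact: open_measurable.
have U_lt : (mu U < (Num.min d e)%:E)%E.
  rewrite -(setDUK AU) measureU//; last 2 first.
  - exact: measurableD.
  - by rewrite setDIK.
  by rewrite [X in (X + _)%E]A0 add0e.
(* The list s collects the steps around exceptional points made before x. *)
pose Q x := a <= x /\ exists s : seq (R * R),
  [/\ forall I, I \in s -> a <= I.1 /\ I.1 <= I.2 /\ I.2 <= x,
      pairwise (fun I K : R * R => I.2 <= K.1) s,
      ((\sum_(I <- s) (I.2 - I.1))%:E <= mu (U `&` `]-oo, x[))%E &
      g x <= g a + e * (x - a) + \sum_(I <- s) `|g I.2 - g I.1|].
suff [_ [s [s_ab s_sorted s_len g_b]]] : Q b.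
  have len_lt : \sum_(I <- s) (I.2 - I.1) < Num.min d e.
    rewrite -lte_fin; apply: le_lt_trans s_len _; apply: le_lt_trans U_lt.
    by apply: le_measure; rewrite ?inE//; exact: measurableI.
  move: len_lt; rewrite lt_min => /andP[len_d len_e].
  have := small s s_ab s_sorted len_d => var_lt.
  have : \sum_(I <- s) `|g I.2 - g I.1| <=
      C * (\sum_(I <- s) `|u I.2 - u I.1| + \sum_(I <- s) (I.2 - I.1)).
    rewrite -big_split big_distrr /= big_seq [leRHS]big_seq.
    by apply: ler_sum => I /s_ab[a1 [le12 le2b]]; apply: g_le.
  have : C * (\sum_(I <- s) `|u I.2 - u I.1| + \sum_(I <- s) (I.2 - I.1)) <=
      C * (e + e) by rewrite ler_wpM2l// lerD// ltW.
  have -> : e' = e * K by rewrite /e divfK ?gt_eqF.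
  by rewrite /K; lra.
apply: (@interval_induction Q a b) => //.
  split=> //; exists [::]; split=> //; rewrite ?big_nil ?subrr ?mulr0 ?addr0//.
move=> c /andP[ac cb].
have [cA|cA] := pselect (A c).
  have /nbhs_ballP[r /= r_gt0 rU] : nbhs c U.
    by apply: open_nbhs_nbhs; split=> //; apply: AU.
  exists r => // x y /andP[ax xc] /andP[cy yb] yx.
  move=> [_ [s [s_ax s_sorted s_len g_x]]].
  split; first exact: le_trans ac cy.
  have xy : x <= y := le_trans xc cy.
  exists (rcons s (x, y)); split.
  - move=> I; rewrite mem_rcons inE => /predU1P[->//=|/s_ax[? [? I2]]].
    by do 2!split=> //; apply: le_trans I2 xy.
  - by rewrite pairwise_rcons s_sorted andbT; apply/allP => I /s_ax[_ []].
  - rewrite big_rcons/= EFinD.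
    apply: le_trans (measure_extend mU xy _); first exact: leeD2r.
    move=> z; rewrite /= in_itv/= => /andP[xz zy]; apply: rU.
    by rewrite /ball /= ltr_norml; apply/andP; split; lra.
  - rewrite big_rcons/=; have := ler_norm (g y - g x).
    have : 0 <= e * (y - x) by rewrite mulr_ge0 ?subr_ge0// ltW.
    by lra.
have [dg g_dv dg_le0] : exists2 d, is_derive (c : R) (1 : R) g d & d <= 0.
  by apply: contrapT => no_d; apply: cA; apply: subA => /= c_ok;
    apply: no_d; apply: c_ok; rewrite ac.
have [r r_gt0 g_r] := derive_le0_local g_dv dg_le0 e_gt0.
exists r => // x y /andP[ax xc] /andP[cy yb] yx.
move=> [_ [s [s_ax s_sorted s_len g_x]]].
split; first exact: le_trans ac cy.
have xy : x <= y := le_trans xc cy.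
exists s; split=> //.
- by move=> I /s_ax[? [? I2]]; do 2!split=> //; apply: le_trans I2 xy.
- apply: le_trans s_len _.
  apply: le_measure; rewrite ?inE; try exact: measurableI.
  apply: setIS => z; rewrite /= !in_itv/= => zx; exact: lt_le_trans zx xy.
- by have := g_r x y; rewrite xc cy => /(_ isT yx); lra.
Qed.

End Monotonicity.

(** * The gradient flow follows the path *)

Section GradientFlow.
Context {R : realType} {n : nat}.
Implicit Types (x v p : 'rV[R]_n) (u w : R -> 'rV[R]_n).

Lemma is_derive_affine x v (t : R) :
  is_derive t (1 : R) (fun s : R => x + s *: v) v.
Proof.
have lim_v : h^-1 *: ((x + (h *: (1 : R) + t) *: v) - (x + t *: v))
    @[h --> (0 : R)^'] --> v.
  apply: cvg_near_cst; near=> h.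
  have h_neq0 : h != 0 by near: h; apply: nbhs_dnbhs_neq.
  by rewrite [h *: _]mulr1 scalerDl addrCA addrK scalerA mulVf// scale1r.
by split; [exact: cvgP lim_v | exact: cvg_lim lim_v].
Unshelve. all: by end_near. Qed.

Lemma is_derive_sqnorm w (t : R) d : is_derive t (1 : R) w d ->
  is_derive t (1 : R) (fun s : R => sqnorm (w s)) (2 * dot (w t) d).
Proof.
move=> [w_dv wE].
have entry i : is_derive t (1 : R) (fun s : R => w s 0 i) (d 0 i).
  by split; [exact: (derivable_mxP _ _ _).1 | rewrite -wE derive_mx// mxE].
have sum_dv := is_derive_sum (fun i => is_deriveM (entry i) (entry i)).
have -> : (fun s : R => sqnorm (w s)) =
    \sum_(i < n) ((fun s : R => w s 0 i) * (fun s : R => w s 0 i)).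
  by apply/funext => s; rewrite fct_sumE.
apply: is_derive_eq.
rewrite /dot mulr_sumr; apply: eq_bigr => i _.
by rewrite mulr2n mulrDl mul1r.
Qed.

(** Uniqueness on one piece: the affine motion v also solves the flow, and since
    the subdifferential is monotone the squared distance from u to v has
    derivative at most 0 almost everywhere.  As absolute continuity holds only
    away from 0, and a may be 0, the monotonicity is applied from an a' > a,
    which then tends to a. *)
Lemma gradient_flow_affine (J : 'rV[R]_n -> R) f u x p (a b : R) :
  gradient_flow J f u -> 0 <= a -> a <= b ->
  (forall t, a <= t <= b -> subdiff J (x - (t - a) *: p) p) ->
  u a = x -> u b = x - (b - a) *: p.
Proof.
move=> [_ u_cont u_ac [q u_flow]] a_ge0 + v_flow ua.
rewrite le_eqVlt => /predU1P[<-|ab]; first by rewrite subrr scale0r subr0.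
pose v (t : R) := x - (t - a) *: p; rewrite -/(v b).
have vE : v = fun t : R => (x + a *: p) + t *: - p.
  by apply/funext => t; rewrite /v scalerBl opprB scalerN addrA.
pose g t := sqnorm (u t - v t).
have u_ab : {within `[a, b], continuous u}.
  apply: continuous_subspaceW u_cont => t /=; rewrite in_itv/= => /andP[at_ _].
  exact: le_trans a_ge0 at_.
have v_dv (t : R) : is_derive t (1 : R) v (- p).
  by rewrite vE; apply: is_derive_affine.
have g_decr a' : a < a' -> a' <= b -> g b <= g a'.
  move=> aa' a'b; have a'_gt0 : 0 < a' := le_lt_trans a_ge0 aa'.
  have [M M_ge] : exists M, forall t, a <= t <= b -> `|u t - v t| <= M.
    have /compact_bounded[M0 [_ M0_ge]] :=
      continuous_compact u_ab (@segment_compact _ a b).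
    exists (M0 + 1 + (`|x| + (b - a) * `|p|)) => t /andP[at_ tb].
    apply: le_trans (ler_normB _ _) _; apply: lerD.
      apply: M0_ge; first by rewrite ltrDl.
      by exists t => //=; rewrite in_itv/= at_.
    apply: le_trans (ler_normB _ _) _; rewrite lerD2l normrZ ler_wpM2r//.
    by rewrite ger0_norm ?subr_ge0// lerD2r.
  have M_ge0 : 0 <= M by apply: le_trans (M_ge a _) => //; rewrite lexx ltW.
  pose C := n%:R * ((M + M) * (1 + `|p|)).
  have C_ge0 : 0 <= C by rewrite !mulr_ge0 ?addr_ge0.
  apply: (absolutely_continuous_nonincreasing a'b C_ge0 (u_ac _ _ a'_gt0 a'b)).
    move=> s t a's st tb; apply: le_trans (sqnormB_le _ _) _.
    have as_ : a <= s := le_trans (ltW aa') a's.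
    rewrite /C -!mulrA ler_wpM2l// ler_pM ?addr_ge0//.
      by rewrite lerD// M_ge// ?(le_trans as_ st) ?(le_trans st tb) ?as_.
    have -> : u t - v t - (u s - v s) = (u t - u s) + (t - s) *: p.
      have <- : v s - v t = (t - s) *: p.
        by rewrite vE opprD addrACA subrr add0r !scalerN opprK addrC -scalerBl.
      by rewrite (opprB (u s)) [v s - u s]addrC addrACA [- v t + _]addrC.
    apply: le_trans (ler_normD _ _) _.
    rewrite normrZ ger0_norm ?subr_ge0// [leRHS]mulrDl mul1r.
    have : 0 <= `|p| * `|u t - u s| by rewrite mulr_ge0.
    by rewrite mulrDr (mulrC `|p| (t - s)); lra.
  apply: (@filterS _ (almost_everywhere _) _ _ _ _ u_flow).
  move=> t t_flow /andP[a't tb].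
  have [u_dv q_sub] := t_flow (lt_le_trans a'_gt0 a't).
  have at_ : a <= t := le_trans (ltW aa') a't.
  exists (2 * dot (u t - v t) (- q t - - p)).
    exact: is_derive_sqnorm (is_deriveB u_dv (v_dv t)).
  have p_sub : subdiff J (v t) p by apply: v_flow; rewrite at_.
  have := q_sub (v t); have := p_sub (u t).
  by rewrite (dotC (u t - v t)); move: (u t) (v t) => y z; rewrite !dotE; lra.
apply/eqP; rewrite -subr_eq0; apply/eqP/sqnorm_le0; rewrite -/(g b) leNgt.
apply/negP => gb_gt0.
have [_ u_a _] := (continuous_within_itvP u ab).1 u_ab.
have v_a : v t @[t --> a^'+] --> v a.
  apply: cvg_at_right_filter; apply: differentiable_continuous.
  apply/derivable1_diffP; exact: ex_derive.
have g_a : g t @[t --> a^'+] --> (0 : R).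
  have -> : 0 = dot (u a - v a) (u a - v a).
    by rewrite /v subrr scale0r subr0 ua subrr dot0l.
  by apply: cvg_dot; apply: cvgB.
have [a' [aa' a'b g_lt]] : exists a', [/\ a < a', a' <= b & g a' < g b].
  near (a^'+) => a'; exists a'; split.
  - by near: a'; apply: nbhs_right_gt.
  - by near: a'; apply: nbhs_right_le.
  - by near: a'; apply: cvgr_lt g_a _ gb_gt0.
by have := g_decr a' aa' a'b; rewrite leNgt g_lt.
Unshelve. all: by end_near. Qed.

Lemma gradient_flow_follows (J : 'rV[R]_n -> R) f
    N (tau : nat -> R) (xx pp : nat -> 'rV[R]_n) u :
  critical_path J f N tau xx pp -> gradient_flow J f u ->
  @follows R n N tau xx pp u.
Proof.
move=> path flow.
have piece k t : (k <= N)%N -> tau k <= t -> ((k < N)%N -> t <= tau k.+1) ->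
    u (tau k) = xx k -> u t = xx k - (t - tau k) *: pp k.
  move=> kN tk t_k.
  apply: gradient_flow_affine flow (path_time_ge0 path kN) tk _.
  move=> s /andP[ks st]; apply: (path_segment_subdiff path kN ks) => //.
    by move=> /t_k; apply: le_trans.
  exact: (path_subdiff path).
have nodes k : (k <= N)%N -> u (tau k) = xx k.
  elim: k => [_|k IHk kN].
    by rewrite (path_time0 path) (path_start path); case: flow.
  rewrite (path_next path); apply: piece => //; try exact: ltnW.
    exact/ltW/(path_lt path).
  exact: IHk (ltnW kN).
by move=> k t kN tk t_k; apply: piece => //; apply: nodes.
Qed.

End GradientFlow.

(** * The decomposition theorem *)

Theorem theorem6 (R : realType) (n : nat) (J : 'rV[R]_n -> R) (f : 'rV[R]_n)
  (J_ge0 : forall x, 0 <= J x)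
  (J_convex : convex_function [set: 'rV[R]_n] J)
  (J_lsc : lower_semicontinuous (fun x => (J x)%:E))
  (J_homogeneous : abs_one_homogeneous J)
  (J_PS : PS J)
  (J_MINSUB : MINSUB J)
  (u : R -> 'rV[R]_n)
  (u_VM_or_GF : variational_method J f u \/ gradient_flow J f u) :
  [/\ piecewise_affine u,
      finite_set (slope_changes u),
      f = orth_proj (null_space J) f
          + \sum_(t \in slope_changes u) spectral_coef u t &
      forall s t, slope_changes u s -> slope_changes u t -> s <> t ->
        dot (spectral_coef u s) (spectral_coef u t) = 0].
Proof.
have J_sublin := sublinear_of_convex J_convex J_homogeneous.
have [N [tau [xx [pp path]]]] :=
  critical_path_exists f J_sublin J_ge0 J_PS J_MINSUB.
apply: (follows_decomposition path) => //.
case: u_VM_or_GF => [u_VM|u_GF].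
- exact: (variational_method_follows path u_VM).
- exact: (gradient_flow_follows path u_GF).
Qed.
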